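(* Let $M$ be a finite, loopless matroid with non-empty ground set. Then $a(M)\leq d(M)\leq c^*(M)$.
   Context: The arboricity $a(M)$ of a loopless matroid $M$ is the minimum number of independent sets into which $E(M)$ can be partitioned. A loopless matroid $M$ is $k$-degenerate if every non-empty restriction of $M$ has a cocircuit of size at most $k$; the degeneracy $d(M)$ is the smallest integer $k$ such that $M$ is $k$-degenerate. $c^*(M)$ is the size of a largest cocircuit of $M$. *)

(* Defs.v *)
From mathcomp Require Import all_boot.
From mathcomp Require Import zify.

Set Implicit Arguments.
Unset Strict Implicit.
Unset Printing Implicit Defensive.

(* The ground set is a subset of T (not all of T), so that restrictions of a
   matroid are again matroids over the same carrier type. *)
Record matroid (T : finType) := Matroid {
  ground : {set T};
  indep : pred {set T};
  indep_sub : forall A, indep A -> A \subset ground;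
  indep0 : indep set0;
  indepS : forall A B : {set T}, indep B -> A \subset B -> indep A;
  indep_aug : forall A B : {set T}, indep A -> indep B -> #|A| < #|B| ->
    exists2 x, x \in B :\: A & indep (x |: A)
}.

Section Basics.
Variables (T : finType) (M : matroid T).
Implicit Types A B C I J X : {set T}.

Definition loopless : bool := [forall x in ground M, indep M [set x]].

Definition base B : bool := maxset (indep M) B.

Definition circuit C : bool :=
  minset (fun A => (A \subset ground M) && ~~ indep M A) C.

Definition restrict_indep X A : bool := indep M A && (A \subset X).

Fact restrict_sub X A : restrict_indep X A -> A \subset ground M :&: X.
Proof. by case/andP=> /indep_sub sAE sAX; rewrite subsetI sAE. Qed.

Fact restrict0 X : restrict_indep X set0.
Proof. by rewrite /restrict_indep indep0 sub0set. Qed.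

Fact restrictS X A B : restrict_indep X B -> A \subset B -> restrict_indep X A.
Proof.
case/andP=> iB sBX sAB; rewrite /restrict_indep (indepS iB sAB).
exact: subset_trans sAB sBX.
Qed.

Fact restrict_aug X A B :
  restrict_indep X A -> restrict_indep X B -> #|A| < #|B| ->
  exists2 x, x \in B :\: A & restrict_indep X (x |: A).
Proof.
case/andP=> iA sAX /andP[iB sBX] ltAB.
have [x xBA ixA] := indep_aug iA iB ltAB; exists x => //.
rewrite /restrict_indep ixA subUset sAX sub1set andbT.
by apply: (subsetP sBX); case/setDP: xBA.
Qed.

Definition restrict X : matroid T :=
  Matroid (@restrict_sub X) (restrict0 X) (@restrictS X) (@restrict_aug X).

Lemma indep_extend I J : indep M I -> indep M J -> #|I| <= #|J| ->
  exists K, [/\ indep M K, I \subset K, K \subset I :|: J & #|K| = #|J|].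
Proof.
move=> + iJ; move En: (#|J| - #|I|) => n.
elim: n I En => [|n IHn] I En iI leIJ.
  exists I; split=> //; first exact: subsetUl.
  by apply/eqP; rewrite eqn_leq leIJ -subn_eq0 En.
have ltIJ : #|I| < #|J| by lia.
have [x /setDP[xJ xI] ixI] := indep_aug iI iJ ltIJ.
have cxI : #|x |: I| = #|I|.+1 by rewrite cardsU1 xI.
have [||K [iK sIK sKU cK]] := IHn (x |: I) _ ixI; rewrite ?cxI //; first lia.
exists K; split=> //; first by apply: subset_trans sIK; exact: subsetUr.
apply: (subset_trans sKU); rewrite subUset subsetUr andbT subUset subsetUl.
by rewrite sub1set inE xJ orbT.
Qed.

Lemma base_indep B : base B -> indep M B.
Proof. exact: maxsetp. Qed.

Lemma indep_leq_base I B : indep M I -> base B -> #|I| <= #|B|.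
Proof.
move=> iI /maxsetP[iB maxB]; rewrite leqNgt; apply/negP => ltBI.
have [x /setDP[_ xB] ixB] := indep_aug iB iI ltBI.
by move/negP: xB; apply; rewrite -(maxB _ ixB (subsetUr _ _)) setU11.
Qed.

Lemma card_base_indep I B : indep M I -> base B -> #|I| = #|B| -> base I.
Proof.
move=> iI bB cI; apply/maxsetP; split=> // K iK sIK; apply/eqP.
by rewrite eq_sym eqEcard sIK cI indep_leq_base.
Qed.

(* The dual matroid: its bases are the complements of the bases of M. *)
Definition dual_indep A : bool :=
  (A \subset ground M) && [exists B, base B && [disjoint A & B]].

Fact dual_sub A : dual_indep A -> A \subset ground M.
Proof. by case/andP. Qed.

Fact dual0 : dual_indep set0.
Proof.
have [B bB _] := maxset_exists (indep0 M).
rewrite /dual_indep sub0set; apply/existsP; exists B.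
by rewrite /base bB disjoint_sym disjoints_subset setC0 subsetT.
Qed.

Fact dualS A B : dual_indep B -> A \subset B -> dual_indep A.
Proof.
case/andP=> sBE /existsP[B' /andP[bB' dB]] sAB.
rewrite /dual_indep (subset_trans sAB sBE); apply/existsP; exists B'.
by rewrite bB' (disjointWl sAB dB).
Qed.

Fact dual_aug A B : dual_indep A -> dual_indep B -> #|A| < #|B| ->
  exists2 x, x \in B :\: A & dual_indep (x |: A).
Proof.
case/andP=> sAE /existsP[P /andP[bP dAP]] /andP[sBE].
case/existsP=> Q /andP[bQ dBQ] ltAB.
have iQA : indep M (Q :\: A) by apply: indepS (base_indep bQ) (subsetDl _ _).
have [K [iK sQK sKU cK]] :=
  indep_extend iQA (base_indep bP) (indep_leq_base iQA bP).
have bK : base K := card_base_indep iK bP cK.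
have dAK : [disjoint A & K].
  rewrite disjoint_sym (disjointWl sKU) // disjoint_sym disjoints_subset.
  apply/subsetP=> a aA; rewrite !inE aA /=.
  by rewrite (disjointFr dAP aA).
have [sBK|] := boolP (B :\: A \subset K); last first.
  case/subsetPn=> x xBA xK; exists x => //; case/setDP: xBA => xB xA.
  rewrite /dual_indep subUset sAE sub1set (subsetP sBE) //=.
  apply/existsP; exists K; rewrite bK disjoints_subset subUset sub1set inE xK.
  by rewrite -disjoints_subset.
have sU : (Q :\: A) :|: (B :\: A) \subset K by rewrite subUset sQK.
have cQK : #|K| = #|Q|.
  by apply/eqP; rewrite eqn_leq !indep_leq_base ?base_indep.
have := subset_leq_card sU; rewrite cardsU.
have -> : (Q :\: A) :&: (B :\: A) = set0.
  apply/setP=> x; rewrite !inE; case xB: (x \in B); last by rewrite !andbF.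
  by rewrite (disjointFr dBQ xB) andbF.
have := subset_leq_card (_ : Q :&: A \subset A :\: B).
have -> : Q :&: A \subset A :\: B.
  apply/subsetP=> x; rewrite !inE => /andP[xQ ->].
  by rewrite (disjointFl dBQ xQ).
move=> /(_ isT); have := cardsID A Q; have := cardsID B A.
have := cardsID A B; rewrite (setIC B A) cards0; lia.
Qed.

Definition dual : matroid T := Matroid dual_sub dual0 dualS dual_aug.

End Basics.

Arguments dual {T} M.

Section Invariants.
Variables (T : finType) (M : matroid T).
Implicit Types A C X : {set T}.

Definition cocircuit C : bool := circuit (dual M) C.

(* The bigop is 0 when there are no cocircuits; see cocircuit_exists below. *)
Definition max_cocircuit_size : nat := \max_(C | cocircuit C) #|C|.

Definition indep_partition (k : nat) : bool :=
  [exists P : {set {set T}},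
    [&& partition P (ground M), [forall A in P, indep M A] & #|P| == k]].

Lemma indep_partition_exists : loopless M -> exists k, indep_partition k.
Proof.
move=> /forall_inP lM; pose P := preim_partition id (ground M).
have pP : partition P (ground M) by exact: preim_partitionP.
exists #|P|; apply/existsP; exists P; rewrite pP eqxx andbT /=.
apply/forall_inP=> _ /imsetP[x xE ->]; apply: indepS (lM x xE) _.
by apply/subsetP=> y; rewrite !inE => /andP[_ /eqP->].
Qed.

Definition arboricity (lM : loopless M) : nat :=
  ex_minn (indep_partition_exists lM).

End Invariants.

Arguments arboricity {T} M lM.

Lemma cocircuit_exists (T : finType) (M : matroid T) :
  loopless M -> ground M != set0 -> exists C, cocircuit M C.
Proof.
move=> /forall_inP lM /set0Pn[x xE].
pose D (A : {set T}) := (A \subset ground (dual M)) && ~~ indep (dual M) A.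
have DE : D (ground M).
  rewrite /D subxx /=; apply/negP=> /andP[_ /existsP[B /andP[bB dB]]].
  have := indep_leq_base (lM x xE) bB; rewrite cards1 card_gt0 => /set0Pn[y yB].
  have := subsetP (indep_sub (base_indep bB)) y yB.
  by rewrite (disjointFl dB yB).
by have [C mC _] := minset_exists DE; exists C.
Qed.

Section Degeneracy.
Variables (T : finType) (M : matroid T).

Definition degenerate (k : nat) : bool :=
  [forall X : {set T}, (X \subset ground M) && (X != set0) ==>
    [exists C : {set T}, cocircuit (restrict M X) C && (#|C| <= k)]].

Lemma degenerate_exists : loopless M -> exists k, degenerate k.
Proof.
move=> /forall_inP lM; exists #|T|; apply/forallP=> X.
apply/implyP=> /andP[sXE X0].
have [||C cC] := @cocircuit_exists _ (restrict M X).
- apply/forall_inP=> x /setIP[xE xX].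
  by rewrite /= /restrict_indep lM // sub1set.
- by rewrite /= (setIidPr sXE).
by apply/existsP; exists C; rewrite cC max_card.
Qed.

Definition degeneracy (lM : loopless M) : nat :=
  ex_minn (degenerate_exists lM).

End Degeneracy.

Arguments degeneracy {T} M lM.

(* Main.v *)
Require Import Defs.
From mathcomp Require Import all_boot.

(** The complement of a cocircuit [C] is a hyperplane, so an element of [C] can
    be added to any independent set avoiding [C]. For the first inequality,
    remove a cocircuit [C] of size at most [d(M)] from [M], colour the rest by
    induction, and give the elements of [C] distinct colours. For the second,
    if a cocircuit [C] of [M] meets [X], then [C :&: X] meets every base of the
    restriction of [M] to [X], hence contains a cocircuit of that restriction;
    looplessness provides such a [C] for every non-empty [X]. *)

Set Implicit Arguments.
Unset Strict Implicit.
Unset Printing Implicit Defensive.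

Section Cocircuits.
Variables (T : finType) (M : matroid T).
Implicit Types A B C I X : {set T}.

Lemma codependentP A : A \subset ground M ->
  reflect (forall B, base M B -> ~~ [disjoint A & B]) (~~ indep (dual M) A).
Proof.
move=> sAE; rewrite /= /dual_indep sAE /= negb_exists.
by apply: (iffP forallP) => H B; have := H B; rewrite negb_and -implybE => /implyP.
Qed.

Lemma cocircuit_sub C : cocircuit M C -> C \subset ground M.
Proof. by case/minsetP=> /andP[]. Qed.

Lemma cocircuit_meets_base C B :
  cocircuit M C -> base M B -> ~~ [disjoint C & B].
Proof.
by case/minsetP=> /andP[sCE /(codependentP sCE) dC] _; apply: dC.
Qed.

(** By minimality [C :\ x] is independent in the dual, so some base avoids it; that base still meets
    [C], and can do so only in [x]. *)
Lemma cocircuit_base C x : cocircuit M C -> x \in C ->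
  exists2 B, base M B & B :&: C = [set x].
Proof.
move=> cC xC; have sCE := cocircuit_sub cC.
have sDE : C :\ x \subset ground M by apply: subset_trans (subsetDl _ _) sCE.
have /andP[_ /existsP[B /andP[bB dB]]] : indep (dual M) (C :\ x).
  apply/contraT=> nD; have /minsetP[_ /(_ (C :\ x))] := cC.
  by rewrite sDE nD subsetDl => /(_ isT isT)/setP/(_ x); rewrite !inE eqxx xC.
exists B => //; have := cocircuit_meets_base cC bB.
rewrite -setI_eq0 => /set0Pn[y /setIP[yC yB]].
have eqx z : z \in B -> z \in C -> z = x.
  move=> zB zC; apply/eqP; apply: contraFT (disjointFl dB zB) => zx.
  by rewrite !inE zx.
apply/setP=> z; rewrite !inE; apply/andP/eqP => [[zB zC]|->]; first exact: eqx.
by rewrite -{1}(eqx y).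
Qed.

(** Take a base [B] meeting [C] only in [x], enlarge [I] inside [I :|: (B :\ x)] to one element
    short of a base, and complete it with some [y] in [B]. The result must meet [C], which forces
    [y = x]. *)
Lemma cocircuit_indepU1 C I x :
  cocircuit M C -> x \in C -> indep M I -> [disjoint I & C] ->
  indep M (x |: I).
Proof.
move=> cC xC iI dIC; have [B bB eBC] := cocircuit_base cC xC.
have xB : x \in B by have: x \in B :&: C by [rewrite eBC set11]; case/setIP.
have cB : #|B| = #|B :\ x|.+1 by rewrite (cardsD1 x B) xB.
have iBx : indep M (B :\ x) by apply: indepS (base_indep bB) (subsetDl _ _).
(* [I] avoids [C], so it is not a base and is strictly smaller than [B]. *)
have leI : #|I| <= #|B :\ x|.
  rewrite -ltnS -cB ltn_neqAle (indep_leq_base iI bB) andbT; apply/eqP => eIB.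
  have := cocircuit_meets_base cC (card_base_indep iI bB eIB).
  by rewrite disjoint_sym dIC.
have [K [iK sIK sKU cK]] := indep_extend iI iBx leI.
have ltKB : #|K| < #|B| by rewrite cB cK.
have [y /setDP[yB yK] iyK] := indep_aug iK (base_indep bB) ltKB.
have byK : base M (y |: K).
  by apply: card_base_indep iyK bB _; rewrite cardsU1 yK cB cK.
have memBC z : z \in B -> z \in C -> z = x.
  by move=> zB zC; apply/set1P; rewrite -eBC inE zB.
(* Neither [I] nor [B :\ x] meets [C], so the common element can only be [y]. *)
have /set0Pn[z /setIP[zC /setU1P zyK]] : C :&: (y |: K) != set0.
  by rewrite setI_eq0 cocircuit_meets_base.
have zy : z = y.
  case: zyK => // /(subsetP sKU)/setUP[zI|/setD1P[zx zB]].
    by rewrite (disjointFr dIC zI) in zC.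
  by rewrite (memBC z) ?eqxx in zx.
have <- : y = x by apply: memBC => //; rewrite -zy.
by apply: indepS iyK _; rewrite setUS.
Qed.

Lemma codependent_cocircuit A : A \subset ground M ->
  (forall B, base M B -> ~~ [disjoint A & B]) ->
  exists2 C, cocircuit M C & C \subset A.
Proof.
move=> sAE /(codependentP sAE) dA.
have [|C mC sCA] := @minset_exists _
  (fun A => (A \subset ground (dual M)) && ~~ indep (dual M) A) A.
  by rewrite sAE.
by exists C.
Qed.

(** This is the fundamental cocircuit of [x] for a base [B] containing [x]: a base avoiding the
    complement of [B :\ x] would be too small, so that complement contains a cocircuit, which can
    meet [B] only in [x]. *)
Lemma nonloop_cocircuit x : indep M [set x] ->
  exists2 C, cocircuit M C & x \in C.
Proof.
move=> ix; have [B bB] := maxset_exists ix; rewrite sub1set => xB.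
have [||C cC sC] := @codependent_cocircuit (ground M :\: (B :\ x)).
- exact: subsetDl.
- move=> B' bB'; apply/negP => dB'.
  have sB' : B' \subset B :\ x.
    apply/subsetP=> y yB'; apply: contraFT (disjointFl dB' yB') => yB.
    by rewrite inE yB (subsetP (indep_sub (base_indep bB'))).
  have := leq_trans (indep_leq_base (base_indep bB) bB') (subset_leq_card sB').
  by rewrite (cardsD1 x B) xB ltnn.
exists C => //; have := cocircuit_meets_base cC bB.
rewrite -setI_eq0 => /set0Pn[y /setIP[yC yB]].
have := subsetP sC y yC; rewrite !inE yB andbT negbK => /andP[/eqP yx _].
by rewrite -yx.
Qed.

End Cocircuits.

(** A base of the restriction lies in [X], so if it avoids [C :&: X] it avoids [C]; adding an
    element of [C :&: X] then keeps it independent, against maximality. *)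
Lemma restrict_cocircuit (T : finType) (M : matroid T) (C X : {set T}) :
  cocircuit M C -> C :&: X != set0 ->
  exists2 D, cocircuit (restrict M X) D & D \subset C :&: X.
Proof.
move=> cC /set0Pn[x /setIP[xC xX]]; apply: codependent_cocircuit => /=.
  by rewrite setSI // cocircuit_sub.
move=> B bB; apply/negP => dB.
have /andP[iB sBX] := base_indep bB.
have dBC : [disjoint B & C].
  rewrite disjoint_subset; apply/subsetP=> y yB; rewrite inE.
  by have := disjointFl dB yB; rewrite !inE (subsetP sBX) // andbT => ->.
have ixB : indep (restrict M X) (x |: B).
  rewrite /= /restrict_indep (cocircuit_indepU1 cC) //=.
  by rewrite subUset sub1set xX.
have /maxsetP[_ /(_ _ ixB (subsetUr _ _)) eB] := bB.
by have := disjointFl dBC xC; rewrite -eB setU11.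
Qed.

Lemma degenerate_max_cocircuit_size (T : finType) (M : matroid T) :
  loopless M -> degenerate M (max_cocircuit_size M).
Proof.
move=> /forall_inP lM; apply/forallP=> X; apply/implyP=> /andP[sXE].
case/set0Pn=> x xX; have xE := subsetP sXE x xX.
have [C cC xC] := nonloop_cocircuit (lM x xE).
have [|D cD sD] := restrict_cocircuit (X := X) cC.
  by apply/set0Pn; exists x; rewrite inE xC.
apply/existsP; exists D; rewrite cD /=.
apply: leq_trans (leq_bigmax_cond _ cC).
by apply: subset_leq_card; apply: subset_trans sD (subsetIl _ _).
Qed.

Lemma degenerate_coloring (T : finType) (M : matroid T) k (X : {set T}) :
  degenerate M k -> X \subset ground M ->
  exists f : T -> nat, (forall x, x \in X -> f x < k) /\
    (forall i, indep M [set x in X | f x == i]).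
Proof.
move=> /forallP dM; have [n] := ubnP #|X|; elim: n X => // n IHn X ltX sXE.
have [->|X0] := eqVneq X set0.
  exists (fun=> 0); split=> [x|i]; first by rewrite inE.
  by apply: indepS (indep0 M) _; apply/subsetP=> x; rewrite !inE.
have := dM X; rewrite sXE X0 => /existsP[C /andP[cC leC]].
have sCX : C \subset X.
  by apply: subset_trans (cocircuit_sub cC) _; rewrite /= subsetIr.
have ltXC : #|X :\: C| < #|X|.
  rewrite -(cardsID C X) (setIidPr sCX) -[ltnLHS]add0n ltn_add2r card_gt0.
  (* [C] meets a base of the restriction, so it is non-empty. *)
  have [B bB _] := maxset_exists (indep0 (restrict M X)).
  have := cocircuit_meets_base cC bB.
  by apply: contraNneq => ->; rewrite -setI_eq0 set0I.
have [||f [ltf iF]] := IHn (X :\: C).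
- exact: leq_trans ltXC _.
- exact: subset_trans (subsetDl _ _) sXE.
(* An element of [C] is coloured by its position in [enum C], which is below [#|C| <= k]; colours
   used on [X :\: C] may recur. *)
exists (fun x => if x \in C then index x (enum C) else f x); split=> [x xX|i].
  case: ifP => xC; last by apply: ltf; rewrite inE xC.
  by apply: leq_trans leC; rewrite cardE index_mem mem_enum.
(* Colour [i] occurs at most once in [C]. If it occurs at [x], its class is [x] added to an old
   class, which avoids [C]; otherwise it is an old class. *)
have [x /andP[xC /eqP xi]|noC] :=
  pickP [pred x in C | index x (enum C) == i].
  have : indep (restrict M X) (x |: [set y in X :\: C | f y == i]).
    apply: (cocircuit_indepU1 cC xC).
      rewrite /= /restrict_indep iF; apply/subsetP=> y.
      by rewrite !inE => /andP[/andP[]].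
    rewrite disjoint_subset; apply/subsetP=> y.
    by rewrite !inE => /andP[/andP[]].
  case/andP=> iU _; apply: indepS iU _; apply/subsetP=> y; rewrite !inE.
  case: ifP => yC /andP[yX /eqP yi]; last by rewrite yX yi eqxx orbT.
  apply/orP; left; apply/eqP.
  by apply: (@index_inj _ x (enum C)); rewrite ?mem_enum // yi xi.
apply: indepS (iF i) _; apply/subsetP=> y; rewrite !inE.
case: ifP => yC /andP[yX yi]; last by rewrite yX.
by have := noC y; rewrite /= yC yi.
Qed.

Lemma coloring_indep_partition (T : finType) (M : matroid T) k (f : T -> nat) :
  (forall x, x \in ground M -> f x < k) ->
  (forall i, indep M [set x in ground M | f x == i]) ->
  exists2 j, indep_partition M j & j <= k.
Proof.
move=> ltf iF; pose P := preim_partition f (ground M).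
exists #|P|.
  apply/existsP; exists P; rewrite preim_partitionP eqxx andbT /=.
  apply/forall_inP=> _ /imsetP[x _ ->]; apply: indepS (iF (f x)) _.
  by apply/subsetP=> y; rewrite !inE eq_sym.
pose g (i : 'I_k) := [set x in ground M | f x == i].
have sPg : P \subset g @: 'I_k.
  apply/subsetP=> _ /imsetP[x xE ->]; apply/imsetP; exists (Ordinal (ltf x xE)).
    by [].
  by apply/setP=> y; rewrite !inE eq_sym.
apply: leq_trans (subset_leq_card sPg) _.
by apply: leq_trans (leq_imset_card _ _) _; rewrite card_ord.
Qed.

Theorem proposition4p2 (T : finType) (M : matroid T) (lM : loopless M)
    (E_nonempty : ground M != set0) :
  arboricity M lM <= degeneracy M lM <= max_cocircuit_size M.
Proof.
rewrite /arboricity /degeneracy.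
case: ex_minnP => a _ min_a; case: ex_minnP => d dM min_d; apply/andP; split.
  have [f [ltf iF]] := degenerate_coloring dM (subxx _).
  by have [j /min_a leaj] := coloring_indep_partition ltf iF; apply: leq_trans.
exact/min_d/degenerate_max_cocircuit_size.
Qed.
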